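(* Let $D$ be a finite set of integers greater than $1$, let $\mathcal{A} = \{A_d : d \in D\}$ be a collection of arithmetic progressions with $A_d = a_d + d\mathbb{Z}$, let $p_1,\dots,p_n$ be the distinct prime factors of $Q = \mathrm{lcm}(D)$ in some fixed order, and let $\delta_1,\dots,\delta_n \in [0,1/2]$. Let $\mathbb{P}_i$, $\alpha_i$, $M_i^{(1)}$, $M_i^{(2)}$ and $\nu$ be as defined in the context. If $$\eta := \sum_{i=1}^n \min\bigg\{ M_i^{(1)}, \frac{M_i^{(2)}}{4\delta_i(1-\delta_i)} \bigg\} < 1$$ (where the minimum is interpreted as $M_i^{(1)}$ if $\delta_i = 0$), then $\mathcal{A}$ does not cover the integers. Moreover, the uncovered set $R = \mathbb{Z}\setminus \bigcup_{d \in D} A_d$ has density $$\mathbb{P}_0(R) \ge (1-\eta) \exp\bigg(-\frac{2}{1-\eta}\sum_{d\in D}\frac{\nu(d)}{d}\bigg).$$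
   Context: Write $\mathbb{Z}_m = \mathbb{Z}/m\mathbb{Z}$ and $Q = \prod_{j=1}^n p_j^{\gamma_j}$ with $\gamma_j \ge 1$. For $0 \le i \le n$ put $Q_i = \prod_{j \le i} p_j^{\gamma_j}$ (so $Q_0 = 1$) and $D_i = \{d \in D : d \mid Q_i\}$; for $1\le i\le n$ put $N_i = D_i \setminus D_{i-1}$ and $B_i = \bigcup_{d \in N_i} A_d$. Sets of integers that are periodic mod $Q$ are identified with subsets of $\mathbb{Z}_Q$. A probability measure on $\mathbb{Z}_{Q_i}$ is extended to $\mathbb{Z}_Q$ by spreading the mass of each congruence class mod $Q_i$ uniformly over that class. $\mathbb{P}_0$ is the uniform measure on $\mathbb{Z}_Q$ (so $\mathbb{P}_0(R)$ is the density of $R$). Given $\mathbb{P}_{i-1}$ on $\mathbb{Z}_{Q_{i-1}}$, identify $\mathbb{Z}_{Q_i}$ with $\mathbb{Z}_{Q_{i-1}} \times \mathbb{Z}_{p_i^{\gamma_i}}$ (Chinese Remainder Theorem), write its elements as $(x,y)$, set for $x \in \mathbb{Z}_{Q_{i-1}}$ $$\alpha_i(x) = \frac{|\{ y \in \mathbb{Z}_{p_i^{\gamma_i}} : (x,y) \in B_i \}|}{p_i^{\gamma_i}},$$ and define $\mathbb{P}_i$ on $\mathbb{Z}_{Q_i}$ by $$\mathbb{P}_i(x,y) = \begin{cases} \max\Big\{0, \dfrac{\alpha_i(x)-\delta_i}{\alpha_i(x)(1-\delta_i)}\Big\}\cdot \mathbb{P}_{i-1}(x,y) & \text{if } (x,y)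 \in B_i,\\[2ex] \min\Big\{\dfrac{1}{1-\alpha_i(x)}, \dfrac{1}{1-\delta_i}\Big\} \cdot \mathbb{P}_{i-1}(x,y) & \text{if } (x,y) \notin B_i.\end{cases}$$ $\mathbb{E}_i$ denotes expectation with respect to $\mathbb{P}_i$ (on $\mathbb{Z}_Q$); $\alpha_i$ is viewed as a function on $\mathbb{Z}_Q$ via reduction mod $Q_{i-1}$. Set $M_i^{(1)} = \mathbb{E}_{i-1}[\alpha_i(x)]$, $M_i^{(2)} = \mathbb{E}_{i-1}[\alpha_i(x)^2]$, and for $d \mid Q$, $\nu(d) = \prod_{p_j \mid d} \frac{1}{1-\delta_j}$. *)

(* Defs.v *)
From mathcomp Require Import all_boot all_order all_algebra.
From mathcomp Require Import finmap.
From mathcomp Require Import all_classical all_reals all_analysis.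
Set Implicit Arguments.
Unset Strict Implicit.
Unset Printing Implicit Defensive.
Import Order.TTheory GRing.Theory Num.Theory.
Local Open Scope ring_scope.

(* Z/mZ is represented by 'I_m ('Z_m would be wrong for m = 1); z : 'I_m stands
   for the residue class z + mZ. *)
Definition reduce (m : nat) (m_gt0 : (0 < m)%N) (z : nat) : 'I_m :=
  Ordinal (ltn_pmod z m_gt0).

Definition uniform (R : realType) (m : nat) : 'I_m -> R := fun _ => m%:R^-1.

(* For m %| k, each residue class mod m is the union of k %/ m classes mod k. *)
Definition spread (R : realType) (m : nat) (m_gt0 : (0 < m)%N) (k : nat)
    (mu : 'I_m -> R) : 'I_k -> R :=
  fun z => mu (reduce m_gt0 z) / (k %/ m)%:R.

(* [prob mu S] is only meaningful for S periodic mod m. *)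
Definition prob (R : realType) (m : nat) (mu : 'I_m -> R) (S : set int) : R :=
  \sum_(z : 'I_m | (z : nat)%:Z \in S) mu z.

Definition expect (R : realType) (m : nat) (mu : 'I_m -> R) (f : 'I_m -> R) :
    R :=
  \sum_(z : 'I_m) mu z * f z.

Definition AP (a : nat -> int) (d : nat) : set int :=
  [set z | exists k : int, z = a d + d%:Z * k]%classic.

Definition uncovered (D : {fset nat}) (a : nat -> int) : set int :=
  (~` \bigcup_(d in [set` D]) AP a d)%classic.

Definition lcmD (D : {fset nat}) : nat := \big[lcmn/1%N]_(d <- D) d.

(* Indices start from 0: p_j, gamma_j, delta_j, N_j, B_j, alpha_j and M_j^(k),
   1 <= j <= n, are written here with index j.-1. Only Q_i, D_i, P_i and E_i,
   0 <= i <= n, keep their index. *)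

(* The prime power p_j^gamma_j exactly dividing lcm(D). *)
Definition ppow (D : {fset nat}) (p : seq nat) (j : nat) : nat :=
  (nth 1 p j ^ logn (nth 1 p j) (lcmD D))%N.

Definition Qpart (D : {fset nat}) (p : seq nat) (i : nat) : nat :=
  (\prod_(j < i) ppow D p j)%N.

Lemma Qpart_gt0 (D : {fset nat}) (p : seq nat) (i : nat) : (0 < Qpart D p i)%N.
Proof. by apply: prodn_gt0 => j; rewrite /ppow pfactor_gt0. Qed.

Definition Dpart (D : {fset nat}) (p : seq nat) (i : nat) : {fset nat} :=
  [fset d in D | (d %| Qpart D p i)%N]%fset.

Definition Npart (D : {fset nat}) (p : seq nat) (i : nat) : {fset nat} :=
  (Dpart D p i.+1 `\` Dpart D p i)%fset.

Definition Bpart (D : {fset nat}) (a : nat -> int) (p : seq nat) (i : nat) :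
    set int :=
  (\bigcup_(d in [set` Npart D p i]) AP a d)%classic.

(* alpha_{i+1} : the pair (x, y) in Z/Q_i x Z/p^gamma is the class of [chinese Q_i p^gamma x y]
   in Z/Q_{i+1}. *)
Definition alpha (R : realType) (D : {fset nat}) (a : nat -> int)
    (p : seq nat) (i : nat) (x : 'I_(Qpart D p i)) : R :=
  #|[pred y : 'I_(ppow D p i) |
      (chinese (Qpart D p i) (ppow D p i) x y)%:Z \in Bpart D a p i]|%:R
  / (ppow D p i)%:R.

(* The measure P_i on Z/Q_i. In the inductive step z is the pair (x, y), so that
   x is z mod Q_j, and P_j(x, y) is the extension of P_j from Z/Q_j to
   Z/Q_{j+1}. Divisions by 0 do not occur: al != 0 when z lies in B, and
   al != 1 when it does not. *)
Fixpoint P (R : realType) (D : {fset nat}) (a : nat -> int) (p : seq nat)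
    (delta : nat -> R) (i : nat) : 'I_(Qpart D p i) -> R :=
  match i return 'I_(Qpart D p i) -> R with
  | 0%N => @uniform R (Qpart D p 0)
  | j.+1 => fun z =>
      let al := alpha R a (reduce (Qpart_gt0 D p j) z) in
      let Pj := spread (Qpart_gt0 D p j) (P a delta (i := j)) z in
      if (z : nat)%:Z \in Bpart D a p j
      then Num.max 0 ((al - delta j) / (al * (1 - delta j))) * Pj
      else Num.min (1 - al)^-1 (1 - delta j)^-1 * Pj
  end.

(* P_i extended to Z/QZ, where Q = lcm(D). *)
Definition PQ (R : realType) (D : {fset nat}) (a : nat -> int) (p : seq nat)
    (delta : nat -> R) (i : nat) : 'I_(lcmD D) -> R :=
  spread (Qpart_gt0 D p i) (P a delta (i := i)).

Lemma PQ0E (R : realType) (D : {fset nat}) (a : nat -> int) (p : seq nat)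
    (delta : nat -> R) : PQ a p delta 0 =1 @uniform R (lcmD D).
Proof.
have Q0 : Qpart D p 0 = 1%N by rewrite /Qpart big_ord0.
by move=> z; rewrite /PQ /spread /= /uniform Q0 divn1 invr1 mul1r.
Qed.

(* M_{i+1}^(k) = E_i[alpha_{i+1} ^ k] *)
Definition moment (R : realType) (D : {fset nat}) (a : nat -> int)
    (p : seq nat) (delta : nat -> R) (k i : nat) : R :=
  expect (PQ (D := D) a p delta i)
    (fun z => alpha R a (reduce (Qpart_gt0 D p i) z) ^+ k).

Definition eta (R : realType) (D : {fset nat}) (a : nat -> int) (p : seq nat)
    (delta : nat -> R) : R :=
  \sum_(i < size p)
    let M1 := moment D a p delta 1 i in
    let M2 := moment D a p delta 2 i in
    if delta i == 0 then M1
    else Num.min M1 (M2 / (4 * delta i * (1 - delta i))).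

Definition nu (R : realType) (p : seq nat) (delta : nat -> R) (d : nat) : R :=
  \prod_(j < size p | (nth 1%N p j %| d)%N) (1 - delta j)^-1.

(* Main.v *)
(* Passing from P_(i-1) to P_i multiplies the density by a weight whose mean on
   every fibre over the coordinates other than the i-th is 1, so expectations of
   functions that do not depend on the i-th coordinate are unchanged. Hence
   P_n(B_i) = P_i(B_i), which is at most the i-th term of eta by the pointwise
   bound max(0, x - d) <= x^2 / (4 d) for x = alpha_i, and P_n(R) >= 1 - eta. The
   weights are also at most 1 / (1 - delta_i), so P_i(A_d) <= nu(d) / d, and
   summing over d in N_i bounds E_n[alpha_i] = E_(i-1)[alpha_i].
   On R the density of P_n is a product of factors at most exp (2 alpha_i), whence
   P_0(R) >= E_n[1_R exp (- 2 sum_i alpha_i)], and Jensen's inequality concludes. *)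
Require Import Defs.
From mathcomp Require Import all_boot all_order all_algebra.
From mathcomp Require Import finmap.
From mathcomp Require Import all_classical all_reals all_analysis.
From mathcomp Require Import zify ring lra.
Import Order.TTheory GRing.Theory Num.Theory.
Local Open Scope ring_scope.
Set Implicit Arguments.
Unset Strict Implicit.
Unset Printing Implicit Defensive.

(** * Periodic functions, progressions and residues *)

(* Functions on Z/mZ are encoded as functions on nat invariant modulo m, so that
   no transport is needed between the moduli Q_i. *)
Definition mod_invariant {T : Type} (m : nat) (f : nat -> T) : Prop :=
  forall x y : nat, x = y %[mod m] -> f x = f y.

Lemma mod_invariant_dvd (T : Type) (m k : nat) (f : nat -> T) :
  (m %| k)%N -> mod_invariant m f -> mod_invariant k f.
Proof.
by move=> mk fm x y xy; apply: fm; rewrite -(modn_dvdm x mk) xy modn_dvdm.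
Qed.

(** Translation by s permutes the residue classes modulo m. *)
Lemma sum_shift (V : nmodType) (m s : nat) (f : nat -> V) :
  mod_invariant m f -> \sum_(z < m) f (z + s)%N = \sum_(z < m) f z.
Proof.
case: m => [|m] fm; first by rewrite !big_ord0.
pose h (z : 'I_m.+1) : 'I_m.+1 := inord ((z + s) %% m.+1).
have hE (z : 'I_m.+1) : h z = ((z + s) %% m.+1)%N :> nat.
  by rewrite inordK // ltn_pmod.
have h_inj : injective h.
  move=> x y /(congr1 val); rewrite /= !hE => /eqP; rewrite eqn_modDr.
  by rewrite !modn_small // => /eqP /val_inj.
rewrite [RHS](reindex_inj h_inj) /=; apply: eq_bigr => z _.
by apply: fm; rewrite hE modn_mod.
Qed.

Lemma sum_indicator_le1 (R : numDomainType) (I : finType) (b : pred I) :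
  (forall x y, b x -> b y -> x = y) -> \sum_x (b x)%:R <= 1 :> R.
Proof.
move=> b_uniq; case: (pickP b) => [x bx | b0].
  rewrite (bigD1 x) //= bx big1 ?addr0 // => y /negP yx.
  by case: (boolP (b y)) => // /b_uniq-/(_ _ bx) xy; case: yx; rewrite xy.
by rewrite big1 // => x _; rewrite b0.
Qed.

Lemma mod_invariant_AP (a : nat -> int) (d : nat) :
  mod_invariant d (fun z : nat => z%:Z \in AP a d).
Proof.
suff sub (x y : nat) : x = y %[mod d] -> x%:Z \in AP a d -> y%:Z \in AP a d.
  by move=> x y xy; apply/idP/idP; apply: sub.
move=> xy; rewrite !inE => -[k xE].
(* Both numbers have the same remainder modulo d, so only the quotients differ. *)
exists (k + (y %/ d)%N%:Z - (x %/ d)%N%:Z).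
have := divn_eq x d; have := divn_eq y d; rewrite -xy; move: xE.
by move: (x %/ d)%N (y %/ d)%N (x %% d)%N; lia.
Qed.

(* The shifts of A_d by 0, ..., d - 1 are disjoint and equinumerous mod m. *)
Lemma card_AP_le (R : realFieldType) (a : nat -> int) (d m : nat) :
  (0 < d)%N -> (d %| m)%N ->
  \sum_(z < m) ((z : nat)%:Z \in AP a d)%:R <= m%:R / d%:R :> R.
Proof.
move=> d_gt0 dm.
rewrite ler_pdivlMr ?ltr0n // mulrC -[d in d%:R]card_ord mulr_natl -sumr_const.
pose f (z : nat) : R := (z%:Z \in AP a d)%:R.
have fm : mod_invariant m f.
  apply: mod_invariant_dvd dm _ => x y /mod_invariant_AP xy.
  by rewrite /f xy.
rewrite (eq_bigr (fun s : 'I_d => \sum_(z < m) f (z + s)%N)); last first.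
  by move=> s _; rewrite sum_shift.
rewrite exchange_big /= -[m in leRHS]card_ord -sumr_const.
apply: ler_sum => z _; apply: sum_indicator_le1 => s t.
rewrite !inE => -[k kE] [l lE]; apply: val_inj => /=.
(* Since s and t lie in [0, d), a multiple of d equal to s - t must be 0. *)
have : s%:Z - t%:Z = d%:Z * (k - l) by move: kE lE; nia.
have := ltn_ord s; have := ltn_ord t.
have [/= -> | [/= kl | /= kl]] : k - l = 0 \/ 1 <= k - l \/ k - l <= -1 by lia.
- by lia.
- by nia.
- by nia.
Qed.

Lemma chinese_reduce (m1 m2 : nat) (m1_gt0 : (0 < m1)%N) (m2_gt0 : (0 < m2)%N)
    (z : nat) : coprime m1 m2 ->
  chinese m1 m2 (reduce m1_gt0 z) (reduce m2_gt0 z) = z %[mod m1 * m2].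
Proof. by move=> co; rewrite /= -chinese_mod. Qed.

Lemma reduce_inv (m : nat) (m_gt0 : (0 < m)%N) :
  mod_invariant m (reduce m_gt0).
Proof. by move=> x y xy; apply: val_inj. Qed.

(** L is invertible modulo m, so its multiples by t < m run once through Z/m; this supplies the
    reindexing of a fibre. *)
Lemma reduce_step_inj (m L : nat) (m_gt0 : (0 < m)%N) (z : nat) :
  coprime m L -> injective (fun t : 'I_m => reduce m_gt0 (z + t * L)).
Proof.
move=> co s t /(congr1 val) /= /eqP; rewrite eqn_modDl => /eqP st.
apply: val_inj => /=; wlog le_st : s t st / (s <= t)%N.
  by move=> wl; case: (leqP s t) => [|/ltnW] le; [|symmetry]; apply: wl.
have /eqP := esym st; rewrite eqn_mod_dvd ?leq_mul2r ?le_st ?orbT //.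
rewrite -mulnBl Gauss_dvdl // => /dvdnP[[|k]]; last by have := ltn_ord t; nia.
by move: le_st; lia.
Qed.

(** * The two weights as functions of x = alpha_i and d = delta_i *)

Section Weights.
Variables (R : realType) (x d : R).
Hypotheses (x01 : 0 <= x <= 1) (d_bound : 0 <= d <= 2^-1).

Let d1_gt0 : 0 < 1 - d.
Proof. by move: d_bound; lra. Qed.

Definition in_weight : R := Num.max 0 ((x - d) / (x * (1 - d))).
Definition out_weight : R := Num.min (1 - x)^-1 (1 - d)^-1.

Lemma in_weight_ge0 : 0 <= in_weight.
Proof. by rewrite /in_weight le_max lexx. Qed.

Lemma out_weight_ge0 : 0 <= out_weight.
Proof.
rewrite /out_weight le_min !invr_ge0; apply/andP; split; move: x01 d_bound; lra.
Qed.

Lemma in_weightM : x * in_weight = Num.max 0 ((x - d) / (1 - d)).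
Proof.
rewrite /in_weight; have [-> | x0] := eqVneq x 0.
  rewrite mul0r; apply/esym/max_idPl; rewrite sub0r.
  by rewrite pmulr_lle0 ?invr_gt0; move: d_bound; lra.
rewrite maxr_pMr; last by move: x01; lra.
rewrite mulr0; congr Num.max; by field; rewrite x0 lt0r_neq0.
Qed.

(** Conservation of mass on a fibre. If x <= d, all the mass leaves B; otherwise B keeps (x - d) /
    (1 - d) and the complement gets (1 - x) / (1 - d). The case x = 1 is separate because (1 - x)^-1
    is then 0. *)
Lemma mean_weight : x * in_weight + (1 - x) * out_weight = 1.
Proof.
rewrite in_weightM; have [xd | dx] := leP x d.
  have xd' : (x - d) / (1 - d) <= 0.
    by rewrite pmulr_lle0 ?invr_gt0; move: xd d_bound; lra.
  rewrite (max_idPl xd') add0r /out_weight min_l ?divff //.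
    by apply: lt0r_neq0; move: xd d_bound; lra.
  by rewrite lef_pV2 ?posrE; move: xd d_bound; lra.
have dx' : 0 <= (x - d) / (1 - d).
  by rewrite pmulr_lge0 ?invr_gt0; move: dx d_bound; lra.
rewrite (max_idPr dx') /out_weight; have [-> | x1] := eqVneq x 1.
  by rewrite subrr mul0r addr0 divff // lt0r_neq0.
have {}x1 : x < 1 by rewrite lt_neqAle x1; case/andP: x01.
rewrite min_r; last by rewrite lef_pV2 ?posrE; move: x1 dx d_bound; lra.
by field; exact: lt0r_neq0.
Qed.

Lemma out_weight_le : out_weight <= (1 - d)^-1.
Proof. by rewrite /out_weight ge_min lexx orbT. Qed.

Lemma in_weight_le : in_weight <= (1 - d)^-1.
Proof.
have d1 : 0 <= (1 - d)^-1 by rewrite invr_ge0; move: d_bound; lra.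
rewrite /in_weight ge_max d1 /=; have [-> | x0] := eqVneq x 0.
  by rewrite mul0r invr0 mulr0.
have {}x0 : 0 < x by rewrite lt_def x0; case/andP: x01.
rewrite invfM mulrA ler_piMl // ler_pdivrMr // mul1r.
by move: d_bound; lra.
Qed.

Lemma in_weightM_le1 : x * in_weight <= x.
Proof.
rewrite in_weightM ge_max; have /andP[-> x1] /= := x01.
rewrite ler_pdivrMr; last by move: d_bound; lra.
by move: x1 d_bound; nra.
Qed.

(** After clearing denominators this is (x - 2 d)^2 >= 0; it produces the second entry of the
    minimum in [eta]. *)
Lemma in_weightM_le2 : d != 0 -> x * in_weight <= x ^+ 2 / (4 * d * (1 - d)).
Proof.
move=> d0; have {}d0 : 0 < d by rewrite lt_def d0; case/andP: d_bound.
have d1 : 0 < 1 - d by move: d_bound; lra.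
rewrite in_weightM ge_max divr_ge0 ?sqr_ge0 //=; last first.
  by rewrite !mulr_ge0 // ltW.
rewrite invfM mulrA ler_pM2r ?invr_gt0 //.
rewrite ler_pdivlMr ?mulr_gt0 // -subr_ge0.
suff -> : x ^+ 2 - (x - d) * (4 * d) = (x - 2 * d) ^+ 2 by apply: sqr_ge0.
by ring.
Qed.

(* Where x = 1 the weight [out_weight] is 0, hence an inequality. *)
Lemma out_weightM_le1 : out_weight * Num.max (1 - x) (1 - d) <= 1.
Proof.
have x1 : 0 <= 1 - x by move: x01; lra.
have d1 : 0 < 1 - d by move: d_bound; lra.
rewrite maxr_pMr ?out_weight_ge0 // ge_max; apply/andP; split.
  apply: (@le_trans _ _ ((1 - x)^-1 * (1 - x))).
    by rewrite ler_wpM2r // /out_weight ge_min lexx.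
  by have [-> | nz] := eqVneq (1 - x) 0; rewrite ?mulr0 // mulVf.
rewrite -[leRHS](mulVf (lt0r_neq0 d1_gt0)).
by apply: ler_wpM2r; [exact: ltW | exact: out_weight_le].
Qed.

(** Both cases go through exp (- 2 x) <= 1 / (1 + 2 x). For x <= 1/2, (1 - x) (1 + 2 x) >= 1; for x
    > 1/2 the bound is below 1/2 <= 1 - d, where d <= 1/2 is used in full. *)
Lemma expR_le_max : expR (- (2 * x)) <= Num.max (1 - x) (1 - d).
Proof.
have e2 := expR_ge1Dx (2 * x).
have x2 : 0 < 1 + 2 * x by move: x01; lra.
apply: (@le_trans _ _ (1 + 2 * x)^-1).
  by rewrite expRN lef_pV2 ?posrE ?expR_gt0.
rewrite le_max; have [xh | hx] := leP x 2^-1; apply/orP; [left | right].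
  rewrite -[leLHS]mul1r ler_pdivrMr //; move: x01 xh; nra.
rewrite -[leLHS]mul1r ler_pdivrMr //; move: d_bound hx; nra.
Qed.

End Weights.

(** * Arithmetic of the moduli Q_i and of the parts of Q prime to p_i *)

Section Sieve.
Variables (R : realType) (D : {fset nat}) (a : nat -> int) (p : seq nat).
Hypotheses (D_gt1 : forall d : nat, d \in D -> (1 < d)%N)
  (p_primes : perm_eq p (primes (lcmD D))).

Local Notation Q := (lcmD D).
Local Notation pr i := (nth 1%N p i).
(** The part of Q prime to p_i. By the Chinese remainder theorem, invariance modulo [cofactor i]
    means not depending on the i-th coordinate. *)
Local Notation cofactor i := (Q`_(pr i)^')%N.

Lemma lcmD_gt0 : (0 < Q)%N.
Proof.
rewrite /lcmD big_seq; apply: (big_ind (fun m => 0 < m)%N) => // [m n m0 n0|d].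
  by rewrite lcmn_gt0 m0.
by move=> /D_gt1 /ltnW.
Qed.

Lemma dvdn_lcmD (d : nat) : d \in D -> (d %| Q)%N.
Proof. by move=> dD; rewrite /lcmD (bigD1_seq d) ?fset_uniq ?dvdn_lcml. Qed.

Lemma prime_pr (i : nat) : (i < size p)%N -> prime (pr i).
Proof.
move=> ip; have : pr i \in primes Q by rewrite -(perm_mem p_primes) mem_nth.
by rewrite mem_primes => /andP[].
Qed.

Lemma QpartS (i : nat) : Qpart D p i.+1 = (Qpart D p i * ppow D p i)%N.
Proof. by rewrite /Qpart big_ord_recr. Qed.

Lemma Qpart_size : Qpart D p (size p) = Q.
Proof.
rewrite [RHS](prod_prime_decomp lcmD_gt0) prime_decompE big_map /=.
by rewrite -(perm_big _ p_primes) /= (big_nth 1%N) big_mkord.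
Qed.

Lemma dvdn_Qpart (i j : nat) : (i <= j)%N -> (Qpart D p i %| Qpart D p j)%N.
Proof.
move=> /subnK <-; elim: (j - i)%N => // k IH.
by rewrite addSn QpartS dvdn_mulr.
Qed.

Lemma dvdn_Qpart_lcmD (i : nat) : (i <= size p)%N -> (Qpart D p i %| Q)%N.
Proof. by move=> ip; rewrite -Qpart_size dvdn_Qpart. Qed.

Lemma ppow_part (i : nat) : ppow D p i = (Q`_(pr i))%N.
Proof. by rewrite p_part. Qed.

Lemma ppow_gt0 (i : nat) : (0 < ppow D p i)%N.
Proof. by rewrite ppow_part part_gt0. Qed.

Lemma ppow_cofactor (i : nat) : (ppow D p i * cofactor i)%N = Q.
Proof. by rewrite ppow_part partnC ?lcmD_gt0. Qed.

Lemma cofactor_dvd (i : nat) : (cofactor i %| Q)%N.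
Proof. by rewrite dvdn_part. Qed.

Lemma coprime_cofactor (i : nat) : coprime (ppow D p i) (cofactor i).
Proof. by rewrite ppow_part coprime_partC. Qed.

(** Q_i p_i^gamma_i divides Q, and the prime power cancels. Thus anything defined modulo Q_i is
    constant on the fibres of step i. *)
Lemma dvdn_Qpart_cofactor (i : nat) :
  (i < size p)%N -> (Qpart D p i %| cofactor i)%N.
Proof.
move=> /dvdn_Qpart_lcmD; rewrite QpartS -{1}(ppow_cofactor i) mulnC.
by rewrite dvdn_pmul2l ?ppow_gt0.
Qed.

Lemma dvdn_cofactor (i d : nat) :
  (i < size p)%N -> (d %| Q)%N -> ~~ (pr i %| d)%N -> (d %| cofactor i)%N.
Proof.
move=> ip dQ nd; have d_gt0 := dvdn_gt0 lcmD_gt0 dQ.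
rewrite -(@part_pnat_id (pr i)^' d) ?partn_dvd ?lcmD_gt0 //.
by rewrite p'natE ?prime_pr.
Qed.

(** * The sets B_i and their proportions on fibres *)

Definition inB (i z : nat) : bool := z%:Z \in Bpart D a p i.

Definition fraction (i z : nat) : R := alpha R a (reduce (Qpart_gt0 D p i) z).

Lemma inBP (i z : nat) :
  reflect (exists2 d, d \in Npart D p i & z%:Z \in AP a d) (inB i z).
Proof.
rewrite /inB /Bpart; apply: (iffP idP) => [|[d dN zd]].
  by rewrite in_setE => -[d dN zd]; exists d => //; rewrite in_setE.
by rewrite in_setE; exists d => //; move: zd; rewrite in_setE.
Qed.

Lemma in_Npart (i d : nat) : (d \in Npart D p i) =
  [&& d \in D, (d %| Qpart D p i.+1)%N & ~~ (d %| Qpart D p i)%N].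
Proof. by rewrite !inE; case: (d \in D); rewrite ?andbF //= andbC. Qed.

Lemma mod_invariant_inB (i : nat) : mod_invariant (Qpart D p i.+1) (inB i).
Proof.
suff sub (x y : nat) : x = y %[mod Qpart D p i.+1] -> inB i x -> inB i y.
  by move=> x y xy; apply/idP/idP; apply: sub.
move=> xy /inBP[d dN xd]; apply/inBP; exists d => //; move: dN.
rewrite in_Npart => /and3P[_ dQ _].
by rewrite -(mod_invariant_dvd dQ (@mod_invariant_AP a d) xy).
Qed.

Lemma mod_invariant_fraction (i : nat) :
  mod_invariant (Qpart D p i) (fraction i).
Proof. by move=> x y xy; rewrite /fraction (reduce_inv _ xy). Qed.

Lemma fraction_bounds (i z : nat) : 0 <= fraction i z <= 1.
Proof.
rewrite /fraction /alpha divr_ge0 //= ler_pdivrMr ?ltr0n ?ppow_gt0 // mul1r.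
by rewrite ler_nat -[leqRHS]card_ord max_card.
Qed.

(* Adding [cofactor i] changes only the residue modulo p_i^gamma_i, so the points
   [z + t * cofactor i] form the fibre of z over the other coordinates. *)
Lemma fractionE (i z : nat) : (i < size p)%N ->
  (ppow D p i)%:R * fraction i z =
  \sum_(t < ppow D p i) (inB i (z + t * cofactor i))%:R.
Proof.
move=> ip; rewrite /fraction /alpha mulrC divfK ?pnatr_eq0 -?lt0n ?ppow_gt0 //.
rewrite -sum1_card natr_sum big_mkcond /=.
rewrite (reindex_inj (@reduce_step_inj _ _ (ppow_gt0 i) z (coprime_cofactor i))).
apply: eq_bigr => t _; set z' := (z + t * cofactor i)%N.
have QL := dvdn_Qpart_cofactor ip.
have zz' : z = z' %[mod Qpart D p i].
  rewrite /z'; have /dvdnP[k ->] := QL.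
  by rewrite mulnA [in RHS]addnC modnMDl.
have co : coprime (Qpart D p i) (ppow D p i).
  by rewrite coprime_sym; apply: coprime_dvdr QL (coprime_cofactor i).
(* By the Chinese remainder theorem, z' is the point over z mod Q_i whose second coordinate is its
   residue modulo p_i^gamma_i. *)
have := chinese_reduce (Qpart_gt0 D p i) (ppow_gt0 i) z' co.
rewrite -QpartS -(reduce_inv (Qpart_gt0 D p i) zz') => /mod_invariant_inB <-.
by rewrite inE /= /inB; case: (_ \in Bpart _ _ _ _).
Qed.

(** Summing over the p_i^gamma_i shifts by multiples of [cofactor i] multiplies the sum over Z/Q by
    p_i^gamma_i, leaves f fixed, and turns the indicator of B_i into its fibre count. *)
Lemma fibre_sum (i : nat) (f : nat -> R) :
  (i < size p)%N -> mod_invariant (cofactor i) f ->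
  \sum_(z < Q) f z * (inB i z)%:R = \sum_(z < Q) f z * fraction i z.
Proof.
move=> ip fL; have q0 : (ppow D p i)%:R != 0 :> R.
  by rewrite pnatr_eq0 -lt0n ppow_gt0.
apply: (mulfI q0); transitivity
    (\sum_(t < ppow D p i) \sum_(z < Q)
        f (z + t * cofactor i)%N * (inB i (z + t * cofactor i))%:R).
  rewrite -[X in X%:R]card_ord mulr_natl -sumr_const; apply: eq_bigr => t _.
  rewrite (@sum_shift _ Q (t * cofactor i) (fun z => f z * (inB i z)%:R)) //.
  move=> x y xy; rewrite (mod_invariant_dvd (cofactor_dvd i) fL xy).
  by rewrite (mod_invariant_dvd (dvdn_Qpart_lcmD ip) (@mod_invariant_inB i) xy).
rewrite exchange_big mulr_sumr; apply: eq_bigr => z _.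
rewrite mulrCA fractionE // mulr_sumr; apply: eq_bigr => t _; congr (_ * _).
by apply: fL; rewrite addnC modnMDl.
Qed.

(** * Densities and expectations of the measures P_i *)

Variable delta : nat -> R.
Hypothesis delta_bounds : forall i : nat, (i < size p)%N -> 0 <= delta i <= 2^-1.

(* The density of P_i with respect to the uniform measure. *)
Definition density (i z : nat) : R :=
  (Qpart D p i)%:R * P a delta (reduce (Qpart_gt0 D p i) z).

Definition weight (i z : nat) : R :=
  if inB i z then in_weight (fraction i z) (delta i)
  else out_weight (fraction i z) (delta i).

(** The expectation E_i: [density i z] divided by Q is the mass of z under P_i extended to Z/Q. *)
Definition mean (i : nat) (f : nat -> R) : R :=
  (\sum_(z < Q) density i z * f z) / Q%:R.

Lemma mod_invariant_density (i : nat) :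
  mod_invariant (Qpart D p i) (density i).
Proof. by move=> x y xy; rewrite /density (reduce_inv _ xy). Qed.

Lemma density0 (z : nat) : density 0 z = 1.
Proof.
have Q0 : Qpart D p 0 = 1%N by rewrite /Qpart big_ord0.
by rewrite /density /= /uniform Q0 invr1 mulr1.
Qed.

Lemma densityS (i z : nat) : density i.+1 z = density i z * weight i z.
Proof.
rewrite /density /=; set z' := (z %% _)%N.
have zz' : z' = z %[mod Qpart D p i.+1] by rewrite modn_mod.
have zz'i : z' = z %[mod Qpart D p i].
  have dQ := dvdn_Qpart (leqnSn i).
  by rewrite -(modn_dvdm z' dQ) zz' modn_dvdm.
rewrite /spread (reduce_inv _ zz'i) -/(inB i z') (mod_invariant_inB zz').
rewrite /weight /in_weight /out_weight /fraction QpartS natrM.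
rewrite mulKn ?Qpart_gt0 //.
have q0 : (ppow D p i)%:R != 0 :> R by rewrite pnatr_eq0 -lt0n ppow_gt0.
by case: ifP => _; field.
Qed.

Lemma weight_bounds (i z : nat) : (i < size p)%N ->
  0 <= weight i z <= (1 - delta i)^-1.
Proof.
move=> /delta_bounds di; have x01 := fraction_bounds i z.
rewrite /weight; case: ifP => _; rewrite ?in_weight_ge0 ?out_weight_ge0 //=.
  exact: in_weight_le.
exact: out_weight_le.
Qed.

Lemma density_ge0 (i z : nat) : (i <= size p)%N -> 0 <= density i z.
Proof.
elim: i => [|i IH] ip; first by rewrite density0.
rewrite densityS mulr_ge0 ?IH // 1?ltnW //.
by have /andP[] := weight_bounds z ip.
Qed.

Lemma lcmDr_gt0 : 0 < Q%:R :> R.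
Proof. by rewrite ltr0n lcmD_gt0. Qed.

Lemma ler_mean (i : nat) (f g : nat -> R) : (i <= size p)%N ->
  (forall z, f z <= g z) -> mean i f <= mean i g.
Proof.
move=> ip fg; rewrite ler_pM2r ?invr_gt0 ?lcmDr_gt0 //.
by apply: ler_sum => z _; rewrite ler_wpM2l ?density_ge0.
Qed.

Lemma mean_sum (I : Type) (r : seq I) (i : nat) (f : I -> nat -> R) :
  mean i (fun z => \sum_(j <- r) f j z) = \sum_(j <- r) mean i (f j).
Proof.
rewrite /mean -mulr_suml exchange_big; congr (_ / _).
by apply: eq_bigr => z _; rewrite mulr_sumr.
Qed.

(** [density i] depends only on z mod Q_i, hence is constant along fibres and can be absorbed into f
    in [fibre_sum]. *)
Lemma mean_fibre (i : nat) (f : nat -> R) :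
  (i < size p)%N -> mod_invariant (cofactor i) f ->
  mean i (fun z => f z * (inB i z)%:R) = mean i (fun z => f z * fraction i z).
Proof.
move=> ip fL; congr (_ / _).
under eq_bigr do rewrite mulrA; under [RHS]eq_bigr do rewrite mulrA.
apply: (@fibre_sum _ (fun z => density i z * f z)) => // x y xy.
rewrite (fL _ _ xy); congr (_ * _).
have QL := dvdn_Qpart_cofactor ip.
exact: mod_invariant_dvd QL (@mod_invariant_density i) _ _ xy.
Qed.

Lemma meanD (i : nat) (f g : nat -> R) :
  mean i (fun z => f z + g z) = mean i f + mean i g.
Proof.
rewrite /mean -mulrDl -big_split; congr (_ / _).
by apply: eq_bigr => z _; rewrite mulrDr.
Qed.

Lemma meanZ (i : nat) (c : R) (f : nat -> R) :
  mean i (fun z => c * f z) = c * mean i f.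
Proof.
rewrite /mean mulrA mulr_sumr; congr (_ / _).
by apply: eq_bigr => z _; rewrite mulrCA.
Qed.

Lemma eq_mean (i : nat) (f g : nat -> R) : f =1 g -> mean i f = mean i g.
Proof. by move=> fg; congr (_ / _); apply: eq_bigr => z _; rewrite fg. Qed.

Lemma mod_invariant_fraction_cofactor (i : nat) (g : R -> R) :
  (i < size p)%N -> mod_invariant (cofactor i) (fun z => g (fraction i z)).
Proof.
move=> ip; apply: mod_invariant_dvd (dvdn_Qpart_cofactor ip) _ => x y.
by move=> /mod_invariant_fraction ->.
Qed.

Lemma meanS (i : nat) (f : nat -> R) :
  (i < size p)%N -> mod_invariant (cofactor i) f -> mean i.+1 f = mean i f.
Proof.
move=> ip fL; pose u z := in_weight (fraction i z) (delta i).
pose v z := out_weight (fraction i z) (delta i).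
(* The weight is affine in the indicator of B_i, so [mean_fibre] replaces the indicator by x =
   [fraction i] and leaves the factor x u + (1 - x) v, which is 1. *)
transitivity (mean i (fun z => f z * v z +
                               f z * (u z - v z) * (inB i z)%:R)).
  congr (_ / _); apply: eq_bigr => z _; rewrite densityS /weight -/(u z) -/(v z).
  by case: ifP => _ /=; ring.
rewrite meanD mean_fibre -?meanD //; last first.
  move=> x y xy; rewrite (fL _ _ xy) /u /v.
  by rewrite (@mod_invariant_fraction_cofactor i id ip _ _ xy).
apply: eq_mean => z; have := mean_weight (fraction_bounds i z) (delta_bounds ip).
rewrite -/(u z) -/(v z) => uv.
by rewrite -[RHS]mulr1 -uv; ring.
Qed.

(** Q_i divides the cofactor of every prime of index at least i, so none of the steps from i to j
    affects f. *)
Lemma mean_stable (i j : nat) (f : nat -> R) : (i <= j <= size p)%N ->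
  mod_invariant (Qpart D p i) f -> mean j f = mean i f.
Proof.
move=> /andP[/subnK <-] + fi; elim: (j - i)%N => // k IH kp.
rewrite addSn meanS ?IH // 1?ltnW //.
apply: mod_invariant_dvd fi; apply: dvdn_trans (dvdn_Qpart_cofactor kp).
exact: dvdn_Qpart (leq_addl _ _).
Qed.

Lemma mean1 (i : nat) : (i <= size p)%N -> mean i (fun=> 1) = 1.
Proof.
move=> ip; rewrite (@mean_stable 0) // /mean.
under eq_bigr do rewrite density0 mulr1.
by rewrite sumr_const card_ord divff // gt_eqF ?lcmDr_gt0.
Qed.

Lemma mean_fraction (i : nat) : (i < size p)%N ->
  mean i (fun z => (inB i z)%:R) = mean i (fraction i).
Proof.
move=> ip; have := @mean_fibre i (fun=> 1) ip (fun _ _ _ => erefl).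
rewrite (@eq_mean i _ (fun z => (inB i z)%:R)) => [->|z]; last by rewrite mul1r.
by apply: eq_mean => z; rewrite mul1r.
Qed.

Lemma momentE (k i : nat) : (i < size p)%N ->
  moment D a p delta k i = mean i (fun z => fraction i z ^+ k).
Proof.
move=> ip; rewrite /moment /expect /mean mulr_suml; apply: eq_bigr => z _.
rewrite /PQ /spread /density -/(fraction i z) natf_div; last first.
  exact: dvdn_Qpart_lcmD (ltnW ip).
have Q0 : Q%:R != 0 :> R by rewrite gt_eqF ?lcmDr_gt0.
have Qi0 : (Qpart D p i)%:R != 0 :> R by rewrite pnatr_eq0 -lt0n Qpart_gt0.
by field; rewrite Q0 Qi0.
Qed.

(** * Masses of the sets B_i and of the progressions *)

Definition eta_term (i : nat) : R :=
  let M1 := moment D a p delta 1 i in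
  let M2 := moment D a p delta 2 i in
  if delta i == 0 then M1
  else Num.min M1 (M2 / (4 * delta i * (1 - delta i))).

(** On B_i the density is multiplied by u, and averaging over fibres gives the mean of x u, to which
    [in_weightM_le1] and [in_weightM_le2] apply. *)
Lemma mean_inB_le (i : nat) : (i < size p)%N ->
  mean i.+1 (fun z => (inB i z)%:R) <= eta_term i.
Proof.
move=> ip; have di := delta_bounds ip.
pose x := fraction i; pose u z := in_weight (x z) (delta i).
have -> : mean i.+1 (fun z => (inB i z)%:R) = mean i (fun z => x z * u z).
  transitivity (mean i (fun z => u z * (inB i z)%:R)).
    congr (_ / _); apply: eq_bigr => z _; rewrite densityS /weight /u /x.
    by case: ifP => _; rewrite ?mulr0 ?mulr1.
  rewrite mean_fibre //; first by apply: eq_mean => z; rewrite mulrC.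
  exact: (mod_invariant_fraction_cofactor (fun t => in_weight t (delta i)) ip).
have le1 : mean i (fun z => x z * u z) <= moment D a p delta 1 i.
  rewrite momentE //; apply: ler_mean => [|z]; first exact: ltnW.
  exact: in_weightM_le1 (fraction_bounds i z) di.
rewrite /eta_term; case: ifP => [//|/negbT d0]; rewrite le_min le1 /=.
rewrite momentE // mulrC -meanZ; apply: ler_mean => [|z]; first exact: ltnW.
by rewrite [leRHS]mulrC; exact: in_weightM_le2 (fraction_bounds i z) di d0.
Qed.

Definition nu_upto (i d : nat) : R :=
  \prod_(j < i | (pr j %| d)%N) (1 - delta j)^-1.

Lemma nu_uptoS (i d : nat) : nu_upto i.+1 d =
  nu_upto i d * (if (pr i %| d)%N then (1 - delta i)^-1 else 1).
Proof. by rewrite /nu_upto big_mkcond big_ord_recr /= -big_mkcond. Qed.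

(** Induction on the steps: if p_i divides d, the weight costs at most a factor 1 / (1 - delta_i);
    otherwise A_d is a union of fibres of step i and its mass does not change. *)
Lemma mean_AP_upto (i d : nat) : (i <= size p)%N -> (d %| Q)%N ->
  mean i (fun z => (z%:Z \in AP a d)%:R) <= nu_upto i d / d%:R.
Proof.
move=> + dQ; have d_gt0 := dvdn_gt0 lcmD_gt0 dQ.
elim: i => [|i IH] ip.
  rewrite /nu_upto big_ord0 mul1r /mean; under eq_bigr do rewrite density0 mul1r.
  rewrite ler_pdivrMr ?lcmDr_gt0 // mulrC.
  exact: card_AP_le.
have {IH} := IH (ltnW ip); rewrite nu_uptoS; case: ifPn => [_ | nd] IH.
  have d1 : 0 <= (1 - delta i)^-1.
    by have /andP[] := weight_bounds 0 ip; apply: le_trans.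
  rewrite mulrAC mulrC; apply: le_trans (ler_wpM2l d1 IH).
  rewrite -meanZ ler_pM2r ?invr_gt0 ?lcmDr_gt0 //; apply: ler_sum => z _.
  rewrite densityS mulrA ler_wpM2r // ler_wpM2l ?density_ge0 1?ltnW //.
  by have /andP[] := weight_bounds z ip.
rewrite mulr1 meanS // => x y xy.
have dL := dvdn_cofactor ip dQ nd.
by rewrite (mod_invariant_dvd dL (@mod_invariant_AP a d) xy).
Qed.

Lemma nu_upto_le (i d : nat) : (i <= size p)%N ->
  nu_upto i d <= nu p delta d.
Proof.
suff le k : (k + i <= size p)%N -> nu_upto i d <= nu_upto (k + i) d.
  by move=> ip; have := le (size p - i)%N; rewrite subnK //; apply.
elim: k => // k IH kp; apply: le_trans (IH (ltnW kp)) _.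
rewrite addSn nu_uptoS ler_peMr //.
  apply: prodr_ge0 => j _; rewrite invr_ge0.
  have := delta_bounds (leq_trans (ltn_ord j) (ltnW kp)); lra.
case: ifP => // _; have := delta_bounds kp => dk.
by rewrite invf_ge1; lra.
Qed.

(** Under E_i the fraction can be exchanged for the indicator of B_i, and a union bound over N_i
    reduces to single progressions. *)
Lemma mean_fraction_le (i : nat) : (i < size p)%N ->
  mean i (fraction i) <= \sum_(d <- Npart D p i) nu p delta d / d%:R.
Proof.
move=> ip; rewrite -mean_fraction //.
apply: (@le_trans _ _ (mean i (fun z =>
    \sum_(d <- Npart D p i) (z%:Z \in AP a d)%:R))).
  apply: ler_mean => [|z]; first exact: ltnW.
  case: inBP => [[d dN zd] | _]; last by apply: sumr_ge0.
  by rewrite (bigD1_seq d) ?fset_uniq //= zd lerDl sumr_ge0.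
rewrite mean_sum big_seq [leRHS]big_seq; apply: ler_sum => d.
rewrite in_Npart => /and3P[/dvdn_lcmD dQ _ _].
apply: le_trans (mean_AP_upto (ltnW ip) dQ) _.
by rewrite ler_wpM2r ?invr_ge0 // nu_upto_le // ltnW.
Qed.

(** For d in D, the increment [c i.+1 d - c i d] indicates that d is in N_i, and it telescopes to 1:
    d divides Q_n = Q, and d > 1 does not divide Q_0 = 1. *)
Lemma sum_Npart (F : nat -> R) :
  \sum_(i < size p) \sum_(d <- Npart D p i) F d = \sum_(d <- D) F d.
Proof.
pose c i (d : nat) : R := (d %| Qpart D p i)%:R.
transitivity (\sum_(i < size p) \sum_(d <- D) (c i.+1 d - c i d) * F d).
  apply: eq_bigr => i _; have -> : Npart D p i =
      [fset d in D | (d %| Qpart D p i.+1)%N && ~~ (d %| Qpart D p i)%N]%fset.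
    by apply/fsetP => d; rewrite in_Npart !inE.
  rewrite big_fset big_mkcond; apply: eq_bigr => d _; rewrite /c.
  case: (boolP (d %| Qpart D p i)%N) => [di | _]; last first.
    by rewrite andbT subr0; case: ifP; rewrite ?mul1r ?mul0r.
  by rewrite (dvdn_trans di (dvdn_Qpart (leqnSn i))) subrr mul0r.
rewrite exchange_big /= big_seq [RHS]big_seq; apply: eq_bigr => d dD.
rewrite -mulr_suml -(big_mkord xpredT (fun i => c i.+1 d - c i d)).
rewrite (telescope_sumr (c^~ d)) // /c Qpart_size dvdn_lcmD //.
rewrite [Qpart _ _ _]big_ord0 dvdn1 gtn_eqF ?D_gt1 // subr0 mul1r //.
Qed.

(** * The uncovered set and the final estimate *)

Local Notation Total := (\sum_(d <- D) nu p delta d / d%:R).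
Local Notation eta := (eta D a p delta).
Local Notation free z := ((z : nat)%:Z \in uncovered D a).
Local Notation load z := (\sum_(i < size p) fraction i z).

Lemma uncoveredPn (z : nat) :
  reflect (exists2 i, (i < size p)%N & inB i z) (~~ free z).
Proof.
apply: (iffP idP) => [|[i ip /inBP[d]]].
  move=> /negP; rewrite in_setE => /contrapT[d dD zd].
  have exQ : exists i, (d %| Qpart D p i)%N.
    by exists (size p); rewrite Qpart_size dvdn_lcmD.
  (* The witness is one less than the least index k with d dividing Q_k; that k is positive because
     d > 1. *)
  case: (ex_minnP exQ) => -[|i] di i_min.
    by move: di; rewrite [Qpart _ _ _]big_ord0 dvdn1 gtn_eqF ?D_gt1.
  exists i; first by apply: i_min; rewrite Qpart_size dvdn_lcmD.
  apply/inBP; exists d; last by rewrite in_setE.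
  rewrite in_Npart di; apply/and3P; split => //.
  by apply/negP => /i_min; rewrite ltnn.
rewrite in_Npart => /and3P[dD _ _]; rewrite in_setE => zd.
by apply/negP; rewrite in_setE; apply; exists d.
Qed.

(** Every point lies in R or in some B_i, so a union bound applies. *)
Lemma mean_free_ge : 1 - eta <= mean (size p) (fun z => (free z)%:R).
Proof.
rewrite lerBlDr -[leLHS](mean1 (leqnn _)).
apply: (@le_trans _ _ (mean (size p) (fun z =>
    (free z)%:R + \sum_(i < size p) (inB i z)%:R))).
  apply: ler_mean => // z; case: (boolP (free z)) => [_ | ].
    by rewrite lerDl sumr_ge0.
  move=> /uncoveredPn[i ip iz]; rewrite add0r (bigD1 (Ordinal ip)) //= iz.
  by rewrite lerDl sumr_ge0.
rewrite meanD lerD2l mean_sum; apply: ler_sum => i _.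
(* B_i is periodic modulo Q_{i+1}, so later steps preserve its mass. *)
rewrite (@mean_stable i.+1) ?leqnn ?ltn_ord //; first exact: mean_inB_le.
by move=> x y /mod_invariant_inB ->.
Qed.

Lemma mean_load_le : mean (size p) (fun z => load z) <= Total.
Proof.
rewrite mean_sum -sum_Npart; apply: ler_sum => i _.
rewrite (@mean_stable i) ?leqnn 1?ltnW //; last exact: mod_invariant_fraction.
exact: mean_fraction_le.
Qed.

Lemma load_ge0 (z : nat) : 0 <= load z.
Proof. by apply: sumr_ge0 => i _; have /andP[] := fraction_bounds i z. Qed.

Lemma density_prod (i z : nat) : density i z = \prod_(j < i) weight j z.
Proof.
elim: i => [|i IH]; first by rewrite big_ord0 density0.
by rewrite big_ord_recr densityS IH.
Qed.

(** A point of R avoids every B_i, so all its weights are [out_weight], and each is compensated by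
    exp (- 2 alpha_i) <= max (1 - alpha_i, 1 - delta_i). *)
Lemma density_free_le1 (z : nat) : free z ->
  density (size p) z * expR (- (2 * load z)) <= 1.
Proof.
move=> zR; rewrite density_prod mulr_sumr -sumrN expR_sum -big_split /=.
rewrite -[leRHS](@big1_eq _ 1 *%R _ (index_enum 'I_(size p)) xpredT).
apply: ler_prod => i _; have x01 := fraction_bounds i z.
have di := delta_bounds (ltn_ord i).
have /andP[w0 _] := weight_bounds z (ltn_ord i).
rewrite mulr_ge0 ?expR_ge0 //=.
apply: le_trans (ler_wpM2l w0 (expR_le_max x01 di)) _.
rewrite /weight; case: ifP => [iz | _]; last exact: out_weightM_le1.
have : ~~ free z by apply/uncoveredPn; exists i.
by rewrite zR.
Qed.

(* Jensen's inequality for [exp (- 2 * load)] under P_n conditioned on the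
   uncovered set, proved with the tangent of exp at - K. *)
Lemma mean_uniform_free_ge : eta < 1 ->
  (1 - eta) * expR (- (2 / (1 - eta) * Total)) <=
  (\sum_(z < Q) (free z)%:R) / Q%:R.
Proof.
move=> eta_lt1; set K := 2 / (1 - eta) * Total.
have KE : (1 - eta) * K = 2 * Total.
  by rewrite /K; field; rewrite subr_eq0 gt_eqF.
have T_ge0 : 0 <= Total.
  apply: le_trans mean_load_le; apply: divr_ge0 => //.
  by apply: sumr_ge0 => z _; rewrite mulr_ge0 ?density_ge0 ?load_ge0.
have K_ge0 : 0 <= K.
  by rewrite mulr_ge0 ?divr_ge0 // subr_ge0 ltW.
(* This integrand has mean at least exp (- K) ((1 + K) (1 - eta) - 2 Total), and K is chosen to make
   this (1 - eta) exp (- K). The load is also subtracted off the uncovered set, which only lowers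
   the integrand. *)
apply: (@le_trans _ _ (mean (size p) (fun z => expR (- K) *
    ((1 + K) * (free z)%:R + (- 2) * load z)))).
  rewrite meanZ meanD !meanZ mulrC ler_wpM2l ?expR_ge0 //.
  have := mean_free_ge; have := mean_load_le.
  move: (mean _ _) (mean _ _) => l r; nra.
rewrite ler_pM2r ?invr_gt0 ?lcmDr_gt0 //; apply: ler_sum => z _.
have d_ge0 := density_ge0 z (leqnn (size p)).
case: (boolP (free z)) => zR; last first.
  rewrite mulr0 add0r mulNr mulrN mulrN oppr_le0.
  by rewrite mulr_ge0 // mulr_ge0 ?expR_ge0 // mulr_ge0 ?load_ge0.
apply: le_trans (density_free_le1 zR); rewrite ler_wpM2l //.
have -> : - (2 * load z) = - K + (K - 2 * load z) by ring.
rewrite expRD ler_wpM2l ?expR_ge0 //.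
by apply: le_trans (expR_ge1Dx _); rewrite mulr1 mulNr addrA.
Qed.

Lemma prob_uncoveredE :
  prob (@uniform R Q) (uncovered D a) = (\sum_(z < Q) (free z)%:R) / Q%:R.
Proof.
rewrite /prob mulr_suml big_mkcond; apply: eq_bigr => z _.
by case: ifP => _; rewrite ?mul1r ?mul0r.
Qed.

End Sieve.

Theorem theorem3p1 (R : realType) (D : {fset nat}) (a : nat -> int)
    (p : seq nat) (delta : nat -> R)
    (D_gt1 : forall d : nat, d \in D -> (1 < d)%N)
    (p_primes : perm_eq p (primes (lcmD D)))
    (delta_bounds : forall i : nat, (i < size p)%N -> 0 <= delta i <= 2^-1)
    (eta_lt1 : eta D a p delta < 1) :
  (\bigcup_(d in [set` D]) AP a d)%classic <> [set: int]%classic /\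
  prob (@uniform R (lcmD D)) (uncovered D a) >=
    (1 - eta D a p delta) *
    expR (- (2 / (1 - eta D a p delta) * \sum_(d <- D) nu p delta d / d%:R)).
Proof.
have lower : (1 - eta D a p delta) *
    expR (- (2 / (1 - eta D a p delta) * \sum_(d <- D) nu p delta d / d%:R))
    <= prob (@uniform R (lcmD D)) (uncovered D a).
  by rewrite prob_uncoveredE; apply: mean_uniform_free_ge.
(* A cover would make R empty and its density 0, against the positive lower bound. *)
split=> // cover; move: lower; apply/negP; rewrite -ltNge.
rewrite /prob big_pred0 => [|z]; last first.
  by apply/negbTE/negP; rewrite in_setE /uncovered cover => /(_ I).
by rewrite mulr_gt0 ?expR_gt0 // subr_gt0.
Qed.
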